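(* Let $G=(V,E)$ be a loop-free multigraph and, for each $v\in V$, let $\varphi_v:\mathbb{Z}_+\to\mathbb{R}$ be an arbitrary function. Define $f(\emptyset)=0$ and, for each non-empty $V'\subseteq V$ (in order of increasing $|V'|$), $f(V')=\min_{v\in V'}\{f(V'\setminus\{v\})+\varphi_v(d(v,V'))\}$, and let $g(V')$ be any element of $\arg\min_{v\in V'}\{f(V'\setminus\{v\})+\varphi_v(d(v,V'))\}$. Then for every non-empty $V'\subseteq V$, the minimum of $\sum_{v\in V'}\varphi_v(\overleftarrow{d}(v))$ over all vertex orders of the induced subgraph $G[V']$ equals $f(V')$, and there exists an order attaining this minimum whose last vertex is $g(V')$.
   Context: $d(v,V')$ denotes the number of edges (with multiplicity) joining $v$ to vertices of $V'$. A vertex order of a graph $H$ is a linear ordering $(\sigma_1,\dots,\sigma_m)$ of its vertices; the left-degree $\overleftarrow{d}(v)$ of $v=\sigma_i$ (in $H$) is the number of edges of $H$ joining $v$ to $\{\sigma_1,\dots,\sigma_{i-1}\}$. *)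

(* Defs.v *)
From HB Require Import structures.
From mathcomp Require Import all_boot all_order all_algebra.
From mathcomp Require Import reals.

Set Implicit Arguments.
Unset Strict Implicit.
Unset Printing Implicit Defensive.

Import Order.TTheory GRing.Theory Num.Theory.
Local Open Scope ring_scope.

(* Vertices and edges are drawn from ambient finite types, so that a graph    *)
(* and its induced subgraphs have the same type. Parallel edges are distinct  *)
(* elements of [ET] with the same endpoints; [ends] is irrelevant outside     *)
(* [edges]. Requiring two distinct endpoints is what excludes loops.          *)
Record multigraph (T ET : finType) := Multigraph {
  verts : {set T};
  edges : {set ET};
  ends : ET -> {set T};
  ends_sub : forall e, e \in edges -> ends e \subset verts;
  ends_card : forall e, e \in edges -> #|ends e| = 2%N
}.

Section Induced.
Variables (T ET : finType) (G : multigraph T ET) (A : {set T}).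

Definition induced_edges : {set ET} := [set e in edges G | ends G e \subset A].

Fact induced_ends_sub e :
  e \in induced_edges -> ends G e \subset verts G :&: A.
Proof. by rewrite inE subsetI => /andP[/ends_sub -> ->]. Qed.

Fact induced_ends_card e : e \in induced_edges -> #|ends G e| = 2%N.
Proof. by rewrite inE => /andP[/ends_card]. Qed.

Definition induced : multigraph T ET :=
  Multigraph induced_ends_sub induced_ends_card.

End Induced.

Section Degrees.
Variables (T ET : finType) (H : multigraph T ET).

Definition deg (v : T) (A : {set T}) : nat :=
  #|[set e in edges H | [exists w in A, ends H e == [set v; w]]]|.

Definition vertex_order (s : seq T) : Prop := uniq s /\ s =i verts H.

Definition left_deg (s : seq T) (v : T) : nat :=
  deg v [set u in take (index v s) s].

End Degrees.

Definition is_minimum (R : realType) (X : Type) (P : X -> Prop) (F : X -> R)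
    (m : R) : Prop :=
  (exists x, P x /\ F x = m) /\ (forall x, P x -> m <= F x).

Section SetMin.
Variables (R : realType) (T : finType) (A : {set T}) (F : T -> R).

(* The value 0 on the empty set is a dummy.                                   *)
Definition set_min : R :=
  if [pick v in A] is Some v0 then F [arg min_(v < v0 in A) F v]%O else 0.

Definition set_argmin : {set T} := [set v in A | [forall w in A, F v <= F w]].

Lemma set_minP : A != set0 -> is_minimum (fun v => v \in A) F set_min.
Proof.
rewrite /set_min => A0; case: pickP => [v0 v0A|A_0]; last first.
  by case/set0Pn: A0 => x; rewrite A_0.
by case: arg_minP => // v vA vmin; split; [exists v | exact: vmin].
Qed.

End SetMin.

Section DynamicProgram.
Variables (R : realType) (T ET : finType) (G : multigraph T ET).
Variable phi : T -> nat -> R.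

(* Recursion on the number of vertices; the intended recurrence is [dp0] and  *)
(* [dpE] below.                                                               *)
Fixpoint dp_rec (n : nat) (A : {set T}) : R :=
  if n is n'.+1 then
    set_min A (fun v => dp_rec n' (A :\ v) + phi v (deg G v A))
  else 0.

Definition dp (A : {set T}) : R := dp_rec #|A| A.

Definition dp_step (A : {set T}) (v : T) : R :=
  dp (A :\ v) + phi v (deg G v A).

Lemma dp0 : dp set0 = 0.
Proof. by rewrite /dp cards0. Qed.

Lemma dpE (A : {set T}) : A != set0 -> dp A = set_min A (dp_step A).
Proof.
rewrite -card_gt0 /dp; case cA: #|A| => [//|n] _ /=.
rewrite /set_min; case: pickP => // v0 v0A.
have eqF v : v \in A -> dp_rec n (A :\ v) + phi v (deg G v A) = dp_step A v.
  by move=> vA; move: cA; rewrite /dp_step /dp (cardsD1 v) vA add1n => -[->].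
case: arg_minP => // v vA vmin; case: arg_minP => // w wA wmin.
apply/le_anti/andP; split; first by rewrite -(eqF w wA); exact: vmin.
by rewrite eqF //; exact: wmin.
Qed.

Definition order_cost (H : multigraph T ET) (s : seq T) : R :=
  \sum_(v in verts H) phi v (left_deg H s v).

End DynamicProgram.

(* Main.v *)
(* In an order of [G[A]] ending in [v], the left-degree of [v] is its whole    *)
(* degree [d(v, A)], and deleting [v] changes no other left-degree. The cost   *)
(* thus splits as the cost of an order of [G[A - v]] plus [phi_v(d(v, A))],    *)
(* which is the recurrence that defines [f].                                   *)

Require Import Defs.
From HB Require Import structures.
From mathcomp Require Import all_boot all_order all_algebra.
From mathcomp Require Import reals.

Set Implicit Arguments.
Unset Strict Implicit.
Unset Printing Implicit Defensive.

Import Order.TTheory GRing.Theory Num.Theory.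
Local Open Scope ring_scope.

(** Orders of [G[A]] ending in [v] correspond to orders of [G[A :\ v]] ([vertex_order_rcons]), and
    their costs differ by a term that depends only on [v] and [A] ([order_cost_rcons]). Hence, once
    the last vertex is fixed, the rest can be optimised independently. Peeling last vertices off an
    arbitrary order gives the lower bound ([dp_le_order_cost]); appending a minimiser to an optimal
    order of the remaining vertices attains it ([dp_attained]). *)

Lemma set_argminE (R : realType) (T : finType) (A : {set T}) (F : T -> R) v :
  v \in set_argmin A F -> F v = set_min A F.
Proof.
rewrite inE => /andP[vA /forall_inP vmin].
have A0 : A != set0 by apply/set0Pn; exists v.
have [[w [wA <-]] minA] := set_minP F A0.
by apply/le_anti; rewrite vmin //=; move: (minA v vA).
Qed.

Section OrderCost.
Variables (T ET : finType) (G : multigraph T ET).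
Implicit Types (A B : {set T}) (s : seq T).

(** An edge from [v] to [B] has both ends in [A], so it survives in [G[A]]. Left-degrees can thus
    all be counted in [G], whatever [A] is. *)
Lemma deg_induced A B v :
  v \in A -> B \subset A -> deg (induced G A) v B = deg G v B.
Proof.
move=> vA /subsetP BA; apply: eq_card => e; rewrite !inE -andbA.
congr (_ && _); apply: andb_idl => /exists_inP[w wB /eqP->].
by rewrite subUset !sub1set vA BA.
Qed.

(** This is where loops are excluded: an edge joining [v] to itself would have a singleton as its
    set of ends. It reconciles the left-degree of a last vertex with the degree in the
    recurrence. *)
Lemma deg_setD1 A v : deg G v (A :\ v) = deg G v A.
Proof.
apply: eq_card => e; rewrite !inE; apply: andb_id2l => eG.
apply/exists_inP/exists_inP => -[w wA /eqP vw]; exists w; rewrite ?vw //.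
  by move: wA; rewrite inE => /andP[].
rewrite !inE wA andbT; apply: contra_eq_neq (ends_card eG) => wv.
by rewrite vw wv setUid cards1.
Qed.

Lemma vertex_order_inducedP A s : A \subset verts G ->
  vertex_order (induced G A) s <-> uniq s /\ A = [set u in s].
Proof.
move=> /setIidPr GA; rewrite /vertex_order /= GA; split=> -[us sA]; split=> //.
  by apply/setP=> u; rewrite inE sA.
by move=> u; rewrite sA inE.
Qed.

Lemma vertex_order_rcons A s v : A \subset verts G ->
  vertex_order (induced G A) (rcons s v) <->
  v \in A /\ vertex_order (induced G (A :\ v)) s.
Proof.
move=> AG; have DG := subset_trans (subD1set A v) AG.
rewrite !vertex_order_inducedP // rcons_uniq.
split=> [[/andP[vs us] ->]|[vA [us sA]]].
  rewrite inE mem_rcons mem_head; split=> //; split=> //.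
  apply/setP=> u; rewrite !inE mem_rcons inE.
  by case: eqVneq => [->|//]; rewrite (negbTE vs).
have vs : v \notin s by move/setP/(_ v): sA; rewrite setD11 inE => <-.
rewrite vs us; split=> //; rewrite -(setD1K vA) sA.
by apply/setP=> u; rewrite !inE mem_rcons inE.
Qed.

Variables (R : realType) (phi : T -> nat -> R).

(** In this form [A] no longer occurs in the sum, which can then be split at the last entry of the
    order. *)
Lemma order_cost_seq A s :
  A \subset verts G -> vertex_order (induced G A) s ->
  order_cost phi (induced G A) s =
  \sum_(v <- s) phi v (deg G v [set u in take (index v s) s]).
Proof.
move=> AG /(vertex_order_inducedP _ AG)[us sA].
rewrite /order_cost /= (setIidPr AG) big_uniq //=.
rewrite (eq_bigl (mem s)); last by move=> v; rewrite sA inE.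
apply: eq_bigr => v vs; congr (phi v _); apply: deg_induced.
  by rewrite sA inE.
by rewrite sA; apply/subsetP=> u; rewrite !inE => /mem_take.
Qed.

Lemma order_cost_rcons A s v :
  A \subset verts G -> vertex_order (induced G A) (rcons s v) ->
  order_cost phi (induced G A) (rcons s v) =
  order_cost phi (induced G (A :\ v)) s + phi v (deg G v A).
Proof.
move=> AG oA; have DG := subset_trans (subD1set A v) AG.
have [vA oD] := (vertex_order_rcons _ _ AG).1 oA.
rewrite !order_cost_seq // big_rcons /=.
have [[us sD] [+ _]] := ((vertex_order_inducedP _ DG).1 oD, oA).
rewrite rcons_uniq => /andP[vs _].
congr (_ + phi v _).
  (* The vertices before [u] all lie in [s], so appending [v] does not affect them. *)
  apply: eq_big_seq => u us'; congr (phi u (deg G u _)).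
  by rewrite -cats1 index_cat us' takel_cat // index_size.
(* Since [v] is not in [s], its index is [size s] and its predecessors form [A :\ v]. *)
rewrite -cats1 index_cat (negbTE vs) /= eqxx addn0 take_size_cat //.
by rewrite -sD deg_setD1.
Qed.

(** The last vertex of the order is one candidate in the minimum defining [dp G phi A]; induction
    bounds the cost of what precedes it. *)
Lemma dp_le_order_cost A s :
  A \subset verts G -> vertex_order (induced G A) s ->
  dp G phi A <= order_cost phi (induced G A) s.
Proof.
elim/last_ind: s A => [|s v IHs] A AG oA.
  rewrite order_cost_seq // big_nil.
  have [_ ->] := (vertex_order_inducedP _ AG).1 oA.
  by rewrite set_nil dp0.
have [vA oD] := (vertex_order_rcons _ _ AG).1 oA.
have A0 : A != set0 by apply/set0Pn; exists v.
rewrite order_cost_rcons // dpE //.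
apply: le_trans ((set_minP _ A0).2 v vA) _.
by rewrite lerD2r IHs // (subset_trans (subD1set A v)).
Qed.

Lemma dp_attained A : A \subset verts G ->
  exists2 s, vertex_order (induced G A) s &
             order_cost phi (induced G A) s = dp G phi A.
Proof.
have [n] := ubnP #|A|; elim: n A => // n IHn A ltAn AG.
have [->|A0] := eqVneq A set0.
  have o0 : vertex_order (induced G set0) [::].
    by apply/vertex_order_inducedP; rewrite ?sub0set // set_nil.
  by exists [::]; rewrite // order_cost_seq ?sub0set // big_nil dp0.
have [[v [vA vE]] _] := set_minP (dp_step G phi A) A0.
have DG := subset_trans (subD1set A v) AG.
have [|s os cs] := IHn (A :\ v) _ DG.
  by move: ltAn; rewrite (cardsD1 v) vA.
have oA : vertex_order (induced G A) (rcons s v).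
  exact/vertex_order_rcons.
by exists (rcons s v); rewrite // order_cost_rcons // cs (dpE _ _ A0) -vE.
Qed.

End OrderCost.

Theorem theorem14 (R : realType) (T ET : finType) (G : multigraph T ET)
    (phi : T -> nat -> R) (g : {set T} -> T)
    (hg : forall V' : {set T}, V' \subset verts G -> V' != set0 ->
       g V' \in set_argmin V' (dp_step G phi V'))
    (V' : {set T}) (hV' : V' \subset verts G) (hV'0 : V' != set0) :
  is_minimum (vertex_order (induced G V')) (order_cost phi (induced G V'))
    (dp G phi V') /\
  exists s : seq T,
    vertex_order (induced G V') (rcons s (g V')) /\
    order_cost phi (induced G V') (rcons s (g V')) = dp G phi V'.
Proof.
have gA := hg V' hV' hV'0; have gE := set_argminE gA.
have gV : g V' \in V' by move: gA; rewrite inE => /andP[].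
(* Taking an optimal order of [V'] without [g V'] leaves the last place free for the prescribed
   vertex. *)
have [s os cs] := dp_attained phi (subset_trans (subD1set V' (g V')) hV').
have oV : vertex_order (induced G V') (rcons s (g V')).
  exact/vertex_order_rcons.
have cV : order_cost phi (induced G V') (rcons s (g V')) = dp G phi V'.
  by rewrite order_cost_rcons // cs (dpE _ _ hV'0) -gE.
split; last by exists s.
by split=> [|t ot]; [exists (rcons s (g V')) | exact: dp_le_order_cost].
Qed.
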